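(* If $\mathcal{A} \subseteq M_n$ is an operator algebra all of whose elements are Jordanesque, then $\mathcal{A} = \mathcal{A}_{\rm diag} + \mathcal{A}_{\rm nil}$, where $\mathcal{A}_{\rm diag}$ is the algebra of diagonal matrices in $\mathcal{A}$ and $\mathcal{A}_{\rm nil}$ is the ideal of strictly upper triangular (i.e., nilpotent) matrices in $\mathcal{A}$.
   Context: $M_n=M_n(\mathbb{C})$. An operator algebra in $M_n$ is a complex linear subspace closed under products (not necessarily unital or self-adjoint). A matrix is Jordanesque if it is block diagonal and each diagonal block is upper triangular and constant on its main diagonal (the constant may depend on the block). Strictly upper triangular means upper triangular with zero main diagonal. *)

(* Defs.v *)
From HB Require Import structures.
From mathcomp Require Import all_boot all_order all_algebra.
From mathcomp Require Import complex reals.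

Set Implicit Arguments.
Unset Strict Implicit.
Unset Printing Implicit Defensive.

Import GRing.Theory.
Local Open Scope ring_scope.

(* [is_trig_mx] is *lower* triangularity, hence the transposes below. *)
Definition upper_triangular (F : fieldType) (n : nat) (M : 'M[F]_n) : bool :=
  is_trig_mx M^T.

Definition strictly_upper_triangular (F : fieldType) (n : nat) (M : 'M[F]_n)
  : bool :=
  upper_triangular M && [forall i, M i i == 0].

(* The sizes [p i] of the diagonal blocks are part of the data of the single
   matrix [M]; [castmx] only transports along [\sum_i p i = n]. Empty blocks
   ([p i = 0]) are harmless. *)
Definition jordanesque (F : fieldType) (n : nat) (M : 'M[F]_n) : Prop :=
  exists (k : nat) (p : 'I_k -> nat) (e : (\sum_i p i)%N = n)
         (B : forall i, 'M[F]_(p i)),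
    M = castmx (e, e) (\mxdiag_i B i) /\
    forall i, upper_triangular (B i) /\ exists c : F, forall j, B i j j = c.

(* Linearity is carried by [{vspace _}]. [{aspace _}] is avoided because it
   requires a multiplicative identity, which [A] need not have. *)
Definition operator_algebra (F : fieldType) (n : nat) (A : {vspace 'M[F]_n})
  : Prop :=
  forall M N : 'M[F]_n, M \in A -> N \in A -> M *m N \in A.

Definition two_sided_ideal (F : fieldType) (n : nat) (A J : {vspace 'M[F]_n})
  : Prop :=
  (J <= A)%VS /\
  forall M N : 'M[F]_n, M \in A -> N \in J -> M *m N \in J /\ N *m M \in J.

Definition nilpotent_mx (F : fieldType) (n : nat) (M : 'M[F]_n) : Prop :=
  exists k : nat, M ^+ k = 0.

Definition diag_space (F : fieldType) (n : nat) : {vspace 'M[F]_n} :=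
  (\sum_(i < n) <[delta_mx i i]>)%VS.

Definition strict_upper_space (F : fieldType) (n : nat) : {vspace 'M[F]_n} :=
  (\sum_(i < n) \sum_(j < n | (i < j)%N) <[delta_mx i j]>)%VS.

Definition alg_diag (F : fieldType) (n : nat) (A : {vspace 'M[F]_n})
  : {vspace 'M[F]_n} :=
  (A :&: diag_space F n)%VS.

Definition alg_nil (F : fieldType) (n : nat) (A : {vspace 'M[F]_n})
  : {vspace 'M[F]_n} :=
  (A :&: strict_upper_space F n)%VS.

Lemma mem_diag_space (F : fieldType) (n : nat) (M : 'M[F]_n) :
  (M \in diag_space F n) = is_diag_mx M.
Proof.
apply/idP/is_diag_mxP => [/memv_sumP[f fP ->] i j nij|dM].
  rewrite summxE big1 // => k _.
  have /vlineP[a ->] := fP k isT; rewrite !mxE.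
  case: eqP => [ik|]; rewrite ?mulr0 //; case: eqP => [jk|]; rewrite ?mulr0 //.
  by move: nij; rewrite ik jk eqxx.
rewrite [M]matrix_sum_delta; apply: memv_sumr => i _.
rewrite (bigD1 i) //= big1 ?addr0 => [|j nji]; first exact/memvZ/memv_line.
by rewrite dM ?scale0r // eq_sym.
Qed.

Lemma mem_strict_upper_space (F : fieldType) (n : nat) (M : 'M[F]_n) :
  (M \in strict_upper_space F n) = strictly_upper_triangular M.
Proof.
apply/idP/andP => [/memv_sumP[f fP ->]|[/is_trig_mxP tM /forallP dM]].
  have z (i j : 'I_n) : (j <= i)%N -> (\sum_k f k) i j = 0.
    move=> ji; rewrite summxE big1 // => k _.
    have /memv_sumP[g gP ->] := fP k isT; rewrite summxE big1 // => l kl.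
    have /vlineP[a ->] := gP l kl; rewrite !mxE.
    case: eqP => [ik|]; rewrite ?mulr0 //; case: eqP => [jl|]; rewrite ?mulr0 //.
    by move: kl; rewrite -ik -jl ltnNge ji.
  split; last by apply/forallP => i; rewrite z.
  by apply/is_trig_mxP => i j ij; rewrite mxE z // ltnW.
rewrite [M]matrix_sum_delta; apply: memv_sumr => i _.
rewrite (bigID (fun j : 'I_n => (i < j)%N)) /= [X in _ + X]big1 ?addr0 => [|j].
  by apply: memv_sumr => j _; apply/memvZ/memv_line.
rewrite -leqNgt leq_eqVlt => /orP[/eqP/val_inj->|ji].
  by rewrite (eqP (dM i)) scale0r.
by have := tM _ _ ji; rewrite mxE => ->; rewrite scale0r.
Qed.

Lemma mem_alg_diag (F : fieldType) (n : nat) (A : {vspace 'M[F]_n})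
    (M : 'M[F]_n) :
  (M \in alg_diag A) = (M \in A) && is_diag_mx M.
Proof. by rewrite memv_cap mem_diag_space. Qed.

Lemma mem_alg_nil (F : fieldType) (n : nat) (A : {vspace 'M[F]_n})
    (M : 'M[F]_n) :
  (M \in alg_nil A) = (M \in A) && strictly_upper_triangular M.
Proof. by rewrite memv_cap mem_strict_upper_space. Qed.

(* Main.v *)
Require Import Defs.
From HB Require Import structures.
From mathcomp Require Import all_boot all_order all_algebra.
From mathcomp Require Import complex reals.
Import GRing.Theory.
Local Open Scope ring_scope.

(** Every element [M] of the algebra splits as [M = D + N], with [D] its
    diagonal part and [N] strictly upper triangular; the Jordanesque shape makes
    [D] and [N] commute, so this is the Jordan-Chevalley decomposition and [D]
    is a polynomial in [M]. The polynomial can be chosen without constant term,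
    so [D] stays in the algebra although the algebra need not contain [1]. *)

Lemma jordanesque_upper (F : fieldType) (n : nat) (M : 'M[F]_n) :
  jordanesque M -> upper_triangular M.
Proof.
case=> k [p [e [B [-> HB]]]] {M}; case: n / e; rewrite castmx_id.
rewrite /upper_triangular tr_mxdiag; apply/is_trig_mxblockP; split=> [i j ij|i].
  by rewrite -val_eqE ltn_eqF.
by rewrite eqxx conform_mx_id; case: (HB i).
Qed.

(** A nonzero entry lies inside one diagonal block, where the diagonal is constant. This is what
    makes the diagonal part commute with [M]. *)
Lemma jordanesque_diag_eq (F : fieldType) (n : nat) (M : 'M[F]_n) (i j : 'I_n) :
  jordanesque M -> M i j != 0 -> M i i = M j j.
Proof.
case=> k [p [e [B [-> HB]]]] {M}; case: n / e i j => i j.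
rewrite castmx_id /mxdiag /mxblock !mxE.
have [ij _|_] := eqVneq (tagnat.sig1 i) (tagnat.sig1 j); last first.
  by rewrite mxE => /eqP.
(* The positions inside the blocks have types depending on the block indices, so they are
   generalized before [ij] is rewritten. *)
rewrite !eqxx !conform_mx_id; move: (tagnat.sig2 i) (tagnat.sig2 j).
rewrite ij => a b.
by have [_ [c Hc]] := HB (tagnat.sig1 j); rewrite !Hc.
Qed.

Lemma chinese_locally_constant (F : fieldType) (m : nat) (s : seq F) :
  exists p : {poly F}, {in s, forall a, ('X - a%:P) ^+ m %| p - a%:P}.
Proof.
(* Repeated nodes would break the coprimality of the moduli. *)
suff [p Hp] : exists p : {poly F},
    {in undup s, forall a, ('X - a%:P) ^+ m %| p - a%:P}.
  by exists p => a sa; apply: Hp; rewrite mem_undup.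
elim: (undup s) (undup_uniq s) => [_|a t IHt /= /andP[ta /IHt[p Hp]]].
  by exists 0.
pose Q := \prod_(b <- t) ('X - b%:P) ^+ m.
have /Bezout_eq1_coprimepP[[u v] /= uv] : coprimep Q (('X - a%:P) ^+ m).
  rewrite coprimep_sym; apply: coprimep_expl; rewrite /Q big_seq.
  apply: (big_ind (coprimep ('X - a%:P))) => [|x y|b tb].
  - exact: coprimep1.
  - by rewrite coprimepMr => -> ->.
  apply: coprimep_expr; rewrite coprimep_XsubC root_XsubC.
  by apply: contraNneq ta => <-.
(* By Bezout, [u * Q] is 1 modulo the new modulus and 0 modulo the old ones, so the correction turns
   [p] into [a] at the new node and changes nothing at the others. *)
exists (p + (a%:P - p) * (u * Q)) => b; rewrite inE => /predU1P[->|tb].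
  have -> : u * Q = 1 - v * ('X - a%:P) ^+ m by rewrite -uv addrK.
  rewrite mulrBr mulr1 addrA subrKC addrAC subrr sub0r dvdpNr mulrA.
  exact: dvdp_mull.
rewrite addrAC; apply: dvdp_add; first exact: Hp.
apply/dvdp_mull/dvdp_mull; rewrite /Q (big_rem b) //=; exact: dvdp_mulr.
Qed.

Lemma horner_mx_mem (F : fieldType) (n : nat) (A : {vspace 'M[F]_n.+1})
    (M : 'M[F]_n.+1) (p : {poly F}) :
  operator_algebra A -> M \in A -> root p 0 -> horner_mx M p \in A.
Proof.
move=> HA MA /factor_theorem[q ->]; rewrite polyC0 subr0.
elim/poly_ind: q => [|q c IHq]; first by rewrite mul0r rmorph0 mem0v.
rewrite rmorphM /= horner_mx_X rmorphD /= mulrDl memvD //.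
  by apply: HA => //; move: IHq.
by rewrite horner_mx_C -[_ * _]/(_ *m _) mul_scalar_mx memvZ.
Qed.

Lemma upper_triangularP (F : fieldType) (n : nat) (M : 'M[F]_n) :
  reflect (forall i j : 'I_n, (j < i)%N -> M i j = 0) (upper_triangular M).
Proof.
by apply: (iffP is_trig_mxP) => H i j ij; have := H j i ij; rewrite mxE.
Qed.

Lemma upper_mulmx_diag (F : fieldType) (n : nat) (M N : 'M[F]_n) (i : 'I_n) :
  upper_triangular M -> upper_triangular N -> (M *m N) i i = M i i * N i i.
Proof.
move=> /upper_triangularP uM /upper_triangularP uN.
rewrite mxE (bigD1 i) //= big1 ?addr0 // => j ji.
have [ij|ij|/val_inj ij] := ltngtP i j; last by rewrite ij eqxx in ji.
  by rewrite uN ?mulr0.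
by rewrite uM ?mul0r.
Qed.

(** The characteristic polynomial is ['X^n], so this is Cayley-Hamilton, applied to the transpose
    because [char_poly_trig] concerns lower triangular matrices. *)
Lemma strictly_upper_expr_eq0 (F : fieldType) (n : nat) (N : 'M[F]_n) :
  strictly_upper_triangular N -> N ^+ n = 0.
Proof.
case: n N => [|n] N; first by move=> _; rewrite [LHS]flatmx0 [RHS]flatmx0.
move=> /andP[uN /forallP dN]; apply: trmx_inj; rewrite trmx0.
have := Cayley_Hamilton N^T; rewrite char_poly_trig //.
under eq_bigr => i _ do rewrite mxE (eqP (dN i)) polyC0 subr0.
rewrite prodr_const card_ord rmorphXn /= horner_mx_X => <-.
have trX k : (N ^+ k)^T = N^T ^+ k.
  by elim: k => [|k IHk]; rewrite ?expr0 ?trmx1 // exprS exprSr trmx_mul IHk.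
exact: trX.
Qed.

Definition diag_part {F : fieldType} {n : nat} (M : 'M[F]_n) : 'M[F]_n :=
  diag_mx (\row_i M i i).

Lemma strictly_upper_sub_diag_part (F : fieldType) (n : nat) (M : 'M[F]_n) :
  upper_triangular M -> strictly_upper_triangular (M - diag_part M).
Proof.
move=> /upper_triangularP uM; apply/andP; split.
  apply/upper_triangularP => i j ji.
  by rewrite !mxE (uM _ _ ji) -val_eqE /= gtn_eqF // mulr0n subr0.
by apply/forallP => i; rewrite !mxE eqxx subrr.
Qed.

Lemma diag_part_comm (F : fieldType) (n : nat) (M : 'M[F]_n) :
  (forall i j, M i j != 0 -> M i i = M j j) ->
  diag_part M *m M = M *m diag_part M.
Proof.
move=> HM; apply/matrixP => i j; rewrite mul_diag_mx mul_mx_diag !mxE mulrC.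
by have [->|/HM->] := eqVneq (M i j) 0; rewrite ?mul0r.
Qed.

(* If [D := diag_part M] commutes with [M], then [M - a] acts on the
   [a]-eigenspace of [D] as the nilpotent matrix [M - D]. *)
Lemma row_sub_diag_expr (F : fieldType) (n : nat) (M : 'M[F]_n) (i : 'I_n)
    (k : nat) :
  diag_part M *m M = M *m diag_part M ->
  row i ((M - (M i i)%:M) ^+ k) = row i ((M - diag_part M) ^+ k).
Proof.
move=> cDM; set a := M i i; set D := diag_part M; set N := M - D.
have cN m : GRing.comm (D - a%:M) (N ^+ m).
  apply: commrX; apply/commr_sym/commrB; apply/commr_sym; last exact: comm_scalar_mx.
  by apply: commrB; [exact: esym|].
have r0 : row i (D - a%:M) = 0.
  by apply/rowP => j; rewrite !mxE; case: eqP; rewrite ?mulr0n subrr.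
elim: k => [|k IHk]; first by rewrite !expr0.
have -> : (M - a%:M) ^+ k.+1 = (M - a%:M) ^+ k *m (M - a%:M) by rewrite exprSr.
rewrite row_mul IHk -row_mul.
have -> : M - a%:M = (D - a%:M) + N by rewrite [RHS]addrC /N addrA subrK.
(* Commutation moves [D - a%:M] to the left, where its zero row [i] kills the product. *)
rewrite mulmxDr linearD /= -[N ^+ k *m (D - _)]cN row_mul r0 mul0mx add0r.
by rewrite exprSr.
Qed.

(* A polynomial congruent to each diagonal entry [a] modulo ['X - a]^(n+1) sends
   [M] to its diagonal part; the same congruence at [a = 0] kills its constant
   term. *)
Lemma diag_part_mem (F : fieldType) (n : nat) (A : {vspace 'M[F]_n})
    (M : 'M[F]_n) :
  operator_algebra A -> M \in A -> upper_triangular M ->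
  (forall i j, M i j != 0 -> M i i = M j j) -> diag_part M \in A.
Proof.
case: n A M => [|n] A M HA MA uM HM.
  by rewrite (flatmx0 (diag_part M)) -(flatmx0 M).
have cDM := diag_part_comm _ _ _ HM.
have [p Hp] :=
  chinese_locally_constant _ n.+1 (0 :: [seq M i i | i <- enum 'I_n.+1]).
have p0 : root p 0.
  have := Hp 0; rewrite inE eqxx polyC0 !subr0 => /(_ isT) H.
  by rewrite -dvdp_XsubCl polyC0 subr0; apply: dvdp_trans H; rewrite exprS dvdp_mulr.
suff <- : horner_mx M p = diag_part M by exact: horner_mx_mem.
apply/row_matrixP => i; have Mi : M i i \in 0 :: [seq M i i | i <- enum 'I_n.+1].
  by rewrite inE (map_f (fun j => M j j)) ?orbT ?mem_enum.
have /dvdpP[q Eq] := Hp _ Mi.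
(* The power stands on the left so that row [i] of the product only involves row [i] of the power,
   which vanishes. *)
have -> : p = ('X - (M i i)%:P) ^+ n.+1 * q + (M i i)%:P.
  by rewrite mulrC -Eq subrK.
rewrite rmorphD rmorphM rmorphXn rmorphB /= horner_mx_X horner_mx_C linearD /=.
rewrite -[_ * _]/(_ *m _) row_mul row_sub_diag_expr //.
rewrite strictly_upper_expr_eq0 ?strictly_upper_sub_diag_part //.
rewrite row0 mul0mx add0r; apply/rowP => j; rewrite !mxE.
by case: eqP.
Qed.

Lemma upper_expr_diag (F : fieldType) (n : nat) (M : 'M[F]_n) (i : 'I_n)
    (k : nat) :
  upper_triangular M -> (M ^+ k) i i = (M i i) ^+ k.
Proof.
(* Triangularity of the powers is carried through the induction, since [upper_mulmx_diag] asks for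
   it. *)
move=> uM; suff [] : upper_triangular (M ^+ k) /\ (M ^+ k) i i = M i i ^+ k by [].
elim: k => [|k [uMk IHk]].
  rewrite !expr0 mxE eqxx; split=> //.
  by rewrite /upper_triangular trmx1; apply: scalar_mx_is_trig.
rewrite !exprS -[M * _]/(M *m _) upper_mulmx_diag // IHk; split=> //.
apply/upper_triangularP => a b ba; rewrite mxE big1 // => c _.
have [ca|ac] := ltnP c a; first by rewrite (upper_triangularP _ _ _ uM) ?mul0r.
by rewrite (upper_triangularP _ _ _ uMk) ?mulr0 // (leq_trans ba).
Qed.

Theorem corollary3p9 (R : realType) (n : nat) (A : {vspace 'M[R[i]]_n}) :
  operator_algebra A ->
  (forall M : 'M[R[i]]_n, M \in A -> jordanesque M) ->
  [/\ A = (alg_diag A + alg_nil A)%VS,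
      operator_algebra (alg_diag A),
      two_sided_ideal A (alg_nil A)
    & forall M : 'M[R[i]]_n,
        M \in A -> (strictly_upper_triangular M <-> nilpotent_mx M)].
Proof.
move=> HA HJ.
have uA M : M \in A -> upper_triangular M by move=> /HJ/jordanesque_upper.
split.
- apply/eqP; rewrite eqEsubv subv_add !capvSl !andbT; apply/subvP => M MA.
  have DA : diag_part M \in A.
    by apply: diag_part_mem => // [|i j]; [exact: uA|exact/jordanesque_diag_eq/HJ].
  rewrite -[M](subrK (diag_part M)) addrC memv_add //.
    by rewrite mem_alg_diag DA diag_mx_is_diag.
  by rewrite mem_alg_nil memvB // strictly_upper_sub_diag_part // uA.
- move=> M N; rewrite !mem_alg_diag => /andP[MA /diag_mxP[d dM]].
  move=> /andP[NA /diag_mxP[e eN]]; rewrite HA //= dM eN mulmx_diag.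
  exact: diag_mx_is_diag.
- split=> [|M N MA]; first exact: capvSl.
  rewrite !mem_alg_nil => /andP[NA /andP[uN /forallP dN]].
  rewrite /strictly_upper_triangular !HA //= !uA ?HA //=.
  by split; apply/forallP => i; rewrite upper_mulmx_diag ?uA // (eqP (dN i))
    ?mulr0 ?mul0r.
(* Conversely, the diagonal entries of [M ^+ k = 0] are the [k]-th powers of those of [M], which
   therefore vanish. *)
move=> M MA; split=> [/strictly_upper_expr_eq0|[k Mk0]]; first by exists n.
rewrite /strictly_upper_triangular uA //=; apply/forallP => i.
have := upper_expr_diag _ _ _ i k (uA _ MA); rewrite Mk0 mxE => /esym/eqP.
by rewrite expf_eq0 => /andP[].
Qed.
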